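(* Let $F$ be a field and let $\Gamma=(V,E)$ be a finite uniform layered graph with $V=\coprod_{i=0}^N V_i$. Then the Hilbert series of the algebra $B(\Gamma)$ is $$h(B(\Gamma),\tau)=1+\sum_{a\in V,\ |a|\ge i\ge 1}\dim\big(H^{i-2}(\Gamma_{a,i})\big)\,\tau^i,$$ where the sum is over all pairs $(a,i)$ with $a\in V$ and $i$ an integer such that $1\le i\le |a|$.
   Context: Layered graphs: $\Gamma=(V,E)$ is a directed graph; for $e\in E$, $t(e)$ is its tail and $h(e)$ its head (the edge goes from $t(e)$ to $h(e)$). $\Gamma$ is layered if $V=\coprod_{i=0}^N V_i$ and, writing $|v|=i$ (the level of $v$) for $v\in V_i$, one has $|t(e)|=|h(e)|+1$ for every $e\in E$. $V$ is regarded as a poset: $u>v$ iff there is a directed path (with at least one edge) from $u$ to $v$. Uniform: vertices $v,v'$ of the same level $i>0$ are connected by a down-up sequence if there are $v=v_0,v_1,\dots,v_k=v'$ in $V_i$ and $w_1,\dots,w_k\in V_{i-1}$ with $w_j<v_{j-1}$ and $w_j<v_j$ for $j=1,\dots,k$ (a vertex is connected to itself by the sequence with $k=0$). $\Gamma$ is uniform if for any two edges $e,e'$ with $t(e)=t(e')$, the heads $h(e),h(e')$ are connected by a down-up sequence $v_0,\dots,v_k$ with $v_j<t(e)$ for all $j$. The algebra $B(\Gamma)$: let $V_+=\coprod_{i>0}V_i$ and, for $v\in V_+$, let $S(v)$ be the set of vertices $w$ such that there is an edge from $v$ to $w$. $B(\Gamma)$ is the associative unital $F$-algebra generated by the vertices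 $v\in V_+$ with relations (i) $u\cdot v=0$ for $u,v\in V_+$ if there is no edge from $u$ to $v$; (ii) $v\cdot\sum_{w\in S(v)}w=0$ for every $v$ with $|v|>1$. It is graded with each generator in degree 1, and $h(B,\tau)=\sum_n \dim(B_n)\tau^n$. The graphs $\Gamma_{a,i}$: for $a\in V$ and $i\le|a|$, $\Gamma_{a,i}$ is the subgraph of $\Gamma$ induced by $\{w\in V: a>w,\ |a|-|w|\le i-1\}$, regarded as a poset. Cohomology: for a finite poset $P$, $H^j(P)$ denotes the reduced order cohomology with coefficients in $F$, i.e. the reduced simplicial cohomology of the order complex of $P$. Explicitly, for $j\ge -1$, $C_j(P)$ is the $F$-vector space with basis the $j$-chains $x_0<\dots<x_j$ in $P$ (the empty set is the unique $(-1)$-chain), $d_j:C_j\to C_{j-1}$ is $d_j(x_0,\dots,x_j)=\sum_l(-1)^l(x_0,\dots,\widehat{x_l},\dots,x_j)$, $C^j$ is the dual of $C_j$, $\partial^j:C^{j-1}\to C^j$ is dual to $d_j$, and $H^j(P)=\ker\partial^{j+1}/\operatorname{im}\partial^j$. In particular $H^{-1}(\emptyset)=F$. *)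

(* Defs.v *)
From HB Require Import structures.
From mathcomp Require Import all_boot all_order all_algebra.
From mathcomp Require Import boolp.
From mathcomp Require Import finmap monalg.

Set Implicit Arguments.
Unset Strict Implicit.
Unset Printing Implicit Defensive.

Import Order.TTheory GRing.Theory Quotient.

Local Open Scope ring_scope.
Local Open Scope quotient_scope.

(** * Layered graphs *)

(* Parallel edges are allowed; [level] encodes the decomposition of the vertex
   set into the layers [V_i = level^-1(i)], some of which may be empty. *)
Record layeredGraph (N : nat) := LayeredGraph {
  vertex : finType;
  edge : finType;
  tail : edge -> vertex;
  head : edge -> vertex;
  level : vertex -> nat;
  level_le : forall v, (level v <= N)%N;
  level_tail : forall e, level (tail e) = (level (head e)).+1
}.

Section LayeredGraph.
Context {N : nat} (G : layeredGraph N).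
Local Notation V := (vertex G).

Definition adj : rel V :=
  [rel u v | [exists e : edge G, (tail e == u) && (head e == v)]].

(* [below v u] is [v < u]: a directed path with at least one edge leads from
   [u] to [v]. *)
Definition below : rel V := [rel v u | [exists w, adj u w && connect adj w v]].

Lemma level_adj u v : adj u v -> level u = (level v).+1.
Proof. by case/existsP=> e /andP[/eqP<- /eqP<-]; exact: level_tail. Qed.

Lemma level_connect u v : connect adj u v -> (level v <= level u)%N.
Proof.
case/connectP=> p + ->; elim: p u => //= w p IHp u /andP[/level_adj-> /IHp].
exact: leqW.
Qed.

Lemma level_below v u : below v u -> (level v < level u)%N.
Proof. by case/existsP=> w /andP[/level_adj-> /level_connect]. Qed.

Lemma belowE v u : below v u = (u != v) && connect adj u v.
Proof.
apply/idP/andP=> [vu | [neq_uv /connectP[[|w p] /=]]].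
- split; first by apply: contraTneq (level_below vu) => ->; rewrite ltnn.
  by case/existsP: vu => w /andP[/connect1 uw]; exact: connect_trans.
- by move=> _ vu; rewrite vu eqxx in neq_uv.
- case/andP=> uw wp ->; apply/existsP; exists w; rewrite uw /=.
  by apply/connectP; exists p.
Qed.

Definition vposet : Type := vertex G.

HB.instance Definition _ := Finite.on vposet.

Definition vle : rel vposet := [rel v u | connect adj u v].

Fact vlt_def (x y : vposet) : below x y = (y != x) && vle x y.
Proof. exact: belowE. Qed.

Fact vle_refl : reflexive vle. Proof. by move=> x; exact: connect0. Qed.

Fact vle_anti : antisymmetric vle.
Proof.
move=> x y /andP[xy yx]; apply/eqP; apply: contraTT isT => neq_xy.
have /level_below : below y x by rewrite belowE neq_xy.
by rewrite ltnNge (level_connect xy).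
Qed.

Fact vle_trans : transitive vle.
Proof. by move=> y x z xy yz; exact: connect_trans yz xy. Qed.

Fact vposet_display : Order.disp_t. Proof. exact: Order.Disp tt tt. Qed.

HB.instance Definition _ := Order.isPOrder.Build vposet_display vposet
  vlt_def vle_refl vle_anti vle_trans.

(* One step [v > w < v'] of a down-up sequence. *)
Definition down_up : rel V :=
  [rel v v' | (level v == level v') &&
     [exists w, [&& level v == (level w).+1, below w v & below w v']]].

(* At level 0 there is no room for [w], so that only the sequence with [k = 0]
   exists. *)
Definition uniform : Prop :=
  forall e e' : edge G, tail e = tail e' ->
  exists s : seq V,
    [/\ path down_up (head e) s,
        last (head e) s = head e'
      & all (below^~ (tail e)) (head e :: s)].

Section Induced.
Variable A : {set V}.

Definition ivertex : finType := {v : V | v \in A}.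
Definition iedge : finType :=
  {e : edge G | (tail e \in A) && (head e \in A)}.
Definition itail (e : iedge) : ivertex :=
  exist _ (tail (val e)) (proj1 (andP (valP e))).
Definition ihead (e : iedge) : ivertex :=
  exist _ (head (val e)) (proj2 (andP (valP e))).

Definition induced : layeredGraph N :=
  @LayeredGraph N ivertex iedge itail ihead (fun v => level (val v))
    (fun v => level_le (val v)) (fun e => level_tail (val e)).

End Induced.

Definition lower_graph (a : V) (i : nat) : layeredGraph N :=
  induced [set w | below w a && (level a - level w <= i - 1)%N].

End LayeredGraph.

(** * Reduced order cohomology of a finite poset *)

Section Cohomology.
Context (F : fieldType) {disp : Order.disp_t} (P : finPOrderType disp).

(* Chains are indexed by their number of elements: [chain n] is the set of
   [(n - 1)]-chains, and the index [n] below stands for the degree [n - 1]. *)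
Definition chain (n : nat) : finType := {s : n.-tuple P | sorted <%O s}.

Definition del (n : nat) (l : 'I_n.+1) (s : n.+1.-tuple P) : n.-tuple P :=
  [tuple tnth s (lift l k) | k < n].

Fact del_sorted n (l : 'I_n.+1) (s : chain n.+1) : sorted <%O (del l (val s)).
Proof.
have tn k (lt_kn : (k < n)%N) x0 : nth x0 (del l (val s)) k =
    nth x0 (val s) (bump l k).
  by rewrite -(tnth_nth x0 _ (Ordinal lt_kn)) tnth_mktuple (tnth_nth x0).
case: n l s tn => [|n] l s tn; first by rewrite tuple0.
set x0 := tnth (val s) ord0; apply/(sortedP x0) => i; rewrite size_tuple => lt_in.
have lt_i1n := ltnW lt_in.
have bumpS h k : (bump h k <= k.+1)%N by rewrite -add1n leq_add2r leq_b1.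
rewrite !tn //; apply: (sorted_ltn_nth lt_trans x0 (valP s)).
- by rewrite inE size_tuple; apply: leq_ltn_trans (bumpS _ _) _.
- by rewrite inE size_tuple; apply: leq_ltn_trans (bumpS _ _) _.
- by rewrite ltnNge leq_bump2 -ltnNge.
Qed.

Definition face n (l : 'I_n.+1) (s : chain n.+1) : chain n :=
  exist _ (del l (val s)) (del_sorted l s).

Definition Cchain (n : nat) : vectType F := {ffun chain n -> F^o}.

Definition basis_chain n (s : chain n) : Cchain n :=
  [ffun t => (t == s)%:R : F^o].

Definition bd_fun n (c : Cchain n.+1) : Cchain n :=
  \sum_(s : chain n.+1)
     (c : {ffun _ -> F^o}) s *:
       \sum_(l < n.+1) (-1) ^+ l *: basis_chain (face l s).

Fact bd_fun_is_linear n : linear (@bd_fun n).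
Proof.
move=> k c c'; rewrite /bd_fun scaler_sumr -big_split; apply: eq_bigr => s _.
by rewrite !ffunE scalerDl scalerA.
Qed.
HB.instance Definition _ n :=
  GRing.isLinear.Build F (Cchain n.+1) (Cchain n) _ (@bd_fun n)
    (@bd_fun_is_linear n).

Definition bd n : 'Hom(Cchain n.+1, Cchain n) := linfun (@bd_fun n).

Definition Cochain (n : nat) : vectType F := 'Hom(Cchain n, F^o).

Definition cobd_fun n (f : Cochain n) : Cochain n.+1 := (f \o bd n)%VF.

Fact cobd_fun_is_linear n : linear (@cobd_fun n).
Proof. by move=> k f g; rewrite /cobd_fun comp_lfunDl comp_lfunZl. Qed.
HB.instance Definition _ n :=
  GRing.isLinear.Build F (Cochain n) (Cochain n.+1) _ (@cobd_fun n)
    (@cobd_fun_is_linear n).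

Definition cobd n : 'Hom(Cochain n, Cochain n.+1) := linfun (@cobd_fun n).

Definition cocycles n : {vspace Cochain n} := lker (cobd n).

Definition coboundaries n : {vspace Cochain n} :=
  match n with 0 => 0%VS | n'.+1 => limg (cobd n') end.

(* The quotient of the cocycles by the coboundaries, realized as a complement
   of the coboundaries in the cocycles.  It is the cohomology in degree
   [n - 1]. *)
Definition cohomology n : {vspace Cochain n} :=
  (cocycles n :\: coboundaries n)%VS.

End Cohomology.

Arguments cohomology F {disp} P n.

(** * Algebras given by generators and relations *)

Section FreeAlgebra.
Context (F : fieldType) (X : choiceType).

Definition freeAlg : Type := {malg F[{fmonom X}]}.
HB.instance Definition _ := GRing.Lalgebra.on freeAlg.

Fact freeAlg_scalerAr (k : F) (x y : freeAlg) : k *: (x * y) = x * (k *: y).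
Proof.
apply/malgP => m; rewrite mcoeffZ [in RHS](mcoeffMlw _ (fsubset_refl _) (msuppZ_le k y)).
rewrite mcoeffMl mulr_sumr; apply: eq_bigr => m1 _.
rewrite mulr_sumr; apply: eq_bigr => m2 _.
by rewrite mcoeffZ mulrCA mulrnAr.
Qed.
HB.instance Definition _ :=
  GRing.Lalgebra_isAlgebra.Build F freeAlg freeAlg_scalerAr.

Definition freeGen (x : X) : freeAlg := << fmu x >>.

End FreeAlgebra.

Section QuotientAlgebra.
Context (F : fieldType) (A : algType F) (rel : A -> Prop).

(* Membership in the two-sided ideal generated by [rel]. *)
Definition in_ideal (x : A) : Prop :=
  exists2 s : seq (A * A * A), (forall t, t \in s -> rel t.1.2) &
    x = \sum_(t <- s) t.1.1 * t.1.2 * t.2.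

Definition ideal : {pred A} := fun x => `[< in_ideal x >].

Fact ideal_zmod_closed : zmod_closed ideal.
Proof.
split=> [|x y]; first by apply/asboolP; exists [::]; rewrite ?big_nil.
move=> /asboolP[s sP ->] /asboolP[t tP ->]; apply/asboolP.
exists (s ++ [seq (- u.1.1, u.1.2, u.2) | u <- t]) => [u|].
  by rewrite mem_cat => /orP[/sP //|/mapP[v /tP vP ->]].
rewrite big_cat big_map /= -sumrN; congr (_ + _).
by apply: eq_bigr => u _; rewrite !mulNr.
Qed.
HB.instance Definition _ := GRing.isZmodClosed.Build A ideal ideal_zmod_closed.

Fact idealMl a x : x \in ideal -> a * x \in ideal.
Proof.
move=> /asboolP[s sP ->]; apply/asboolP.
exists [seq (a * u.1.1, u.1.2, u.2) | u <- s] => [u /mapP[v /sP vP ->] //|].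
by rewrite big_map mulr_sumr; apply: eq_bigr => u _; rewrite !mulrA.
Qed.

Fact idealMr a x : x \in ideal -> x * a \in ideal.
Proof.
move=> /asboolP[s sP ->]; apply/asboolP.
exists [seq (u.1.1, u.1.2, u.2 * a) | u <- s] => [u /mapP[v /sP vP ->] //|].
by rewrite big_map mulr_suml; apply: eq_bigr => u _; rewrite !mulrA.
Qed.

Fact idealZ k x : x \in ideal -> k *: x \in ideal.
Proof. by move=> xI; rewrite -[x]mul1r scalerAl; exact: idealMl. Qed.

(* The properness assumption is there because library rings are nontrivial. *)
Context (proper : ~ in_ideal 1).

Local Notation Q0 := (quot ideal).

Definition quotAlg (_ : ~ in_ideal 1) : Type := Q0.
Local Notation Q := (quotAlg proper).

HB.instance Definition _ p := GRing.Zmodule.on (quotAlg p).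

Definition quot_pi (x : A) : Q := \pi_Q0 x.

Fact quot_pi_eq x y : (quot_pi x == quot_pi y) = (x - y \in ideal).
Proof. by rewrite idealrBE. Qed.

Fact quot_pi_repr (x : Q) : quot_pi (repr (x : Q0)) = x.
Proof. exact: reprK. Qed.

Fact quot_piD : {morph quot_pi : x y / x + y}.
Proof. exact: (raddfD (\pi_Q0)). Qed.

Definition quot_one : Q := quot_pi 1.
Definition quot_mul (x y : Q) : Q :=
  quot_pi (repr (x : Q0) * repr (y : Q0)).
Definition quot_scale (k : F) (x : Q) : Q :=
  quot_pi (k *: repr (x : Q0)).

Fact quot_piM x y : quot_pi (x * y) = quot_mul (quot_pi x) (quot_pi y).
Proof.
apply/eqP; rewrite quot_pi_eq.
set x' := repr _; set y' := repr _.
have -> : x * y - x' * y' = (x - x') * y + x' * (y - y').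
  by rewrite mulrBl mulrBr addrA subrK.
have repr_pi z : z - repr (quot_pi z : Q0) \in ideal.
  by rewrite -quot_pi_eq quot_pi_repr.
by apply: rpredD; [apply: idealMr | apply: idealMl]; exact: repr_pi.
Qed.

Fact quot_piZ k x : quot_pi (k *: x) = quot_scale k (quot_pi x).
Proof.
apply/eqP; rewrite quot_pi_eq -scalerBr; apply: idealZ.
by rewrite -quot_pi_eq quot_pi_repr.
Qed.

Local Ltac lift x := rewrite -[x]quot_pi_repr.

Fact quot_mulA : associative quot_mul.
Proof. by move=> x y z; lift x; lift y; lift z; rewrite -!quot_piM mulrA. Qed.
Fact quot_mul1 : left_id quot_one quot_mul.
Proof. by move=> x; lift x; rewrite -quot_piM mul1r. Qed.
Fact quot_mulr1 : right_id quot_one quot_mul.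
Proof. by move=> x; lift x; rewrite -quot_piM mulr1. Qed.
Fact quot_mulDl : left_distributive quot_mul +%R.
Proof.
move=> x y z; lift x; lift y; lift z.
by rewrite -!(quot_piM, quot_piD) mulrDl.
Qed.
Fact quot_mulDr : right_distributive quot_mul +%R.
Proof.
move=> x y z; lift x; lift y; lift z.
by rewrite -!(quot_piM, quot_piD) mulrDr.
Qed.
Fact quot_one_neq0 : quot_one != 0.
Proof.
have -> : 0 = quot_pi 0 by rewrite /quot_pi raddf0.
by rewrite quot_pi_eq subr0; apply/negP => /asboolP.
Qed.
HB.instance Definition _ := GRing.Zmodule_isNzRing.Build Q
  quot_mulA quot_mul1 quot_mulr1 quot_mulDl quot_mulDr quot_one_neq0.

Fact quot_scalerA k l x : quot_scale k (quot_scale l x) = quot_scale (k * l) x.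
Proof. by lift x; rewrite -!quot_piZ scalerA. Qed.
Fact quot_scale1r : left_id 1 quot_scale.
Proof. by move=> x; lift x; rewrite -quot_piZ scale1r. Qed.
Fact quot_scalerDr : right_distributive quot_scale +%R.
Proof.
by move=> k x y; lift x; lift y; rewrite -!(quot_piZ, quot_piD) scalerDr.
Qed.
Fact quot_scalerDl x : {morph quot_scale^~ x : k l / k + l}.
Proof. by move=> k l; lift x; rewrite -!(quot_piZ, quot_piD) scalerDl. Qed.
HB.instance Definition _ := GRing.Zmodule_isLmodule.Build F Q
  quot_scalerA quot_scale1r quot_scalerDr quot_scalerDl.

Fact quot_scalerAl k (x y : Q) : k *: (x * y) = (k *: x) * y.
Proof.
change (quot_scale k (quot_mul x y) = quot_mul (quot_scale k x) y).
by lift x; lift y; rewrite -!(quot_piZ, quot_piM) scalerAl.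
Qed.
HB.instance Definition _ := GRing.Lmodule_isLalgebra.Build F Q quot_scalerAl.

Fact quot_scalerAr k (x y : Q) : k *: (x * y) = x * (k *: y).
Proof.
change (quot_scale k (quot_mul x y) = quot_mul x (quot_scale k y)).
by lift x; lift y; rewrite -!(quot_piZ, quot_piM) scalerAr.
Qed.
HB.instance Definition _ :=
  GRing.Lalgebra_isAlgebra.Build F Q quot_scalerAr.

End QuotientAlgebra.

(** * Hilbert series *)

Section Hilbert.
Context (F : fieldType).

Definition has_dim (W : lmodType F) (S : W -> Prop) (d : nat) : Prop :=
  exists b : 'I_d -> W,
    (forall x, S x <-> exists c : 'I_d -> F, x = \sum_i c i *: b i) /\
    (forall c : 'I_d -> F, \sum_i c i *: b i = 0 -> forall i, c i = 0).

(* The degree [n] component of an algebra generated by the elements [g x], all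
   placed in degree 1: the span of the products of [n] generators. *)
Definition graded_part (A : algType F) (X : finType) (g : X -> A) (n : nat)
    (x : A) : Prop :=
  exists c : n.-tuple X -> F, x = \sum_w c w *: \prod_(v <- w) g v.

(* A power series is given by its sequence of coefficients. *)
Definition is_hilbert_series (W : lmodType F) (gr : nat -> W -> Prop)
    (h : nat -> nat) : Prop :=
  forall n, has_dim (gr n) (h n).

End Hilbert.

(** * The algebra B of a layered graph *)

Section AlgebraB.
Context (F : fieldType) {N : nat} (G : layeredGraph N).

Definition posV : finType := {v : vertex G | (0 < level v)%N}.

Definition FV : algType F := freeAlg F posV.

Definition var (v : posV) : FV := freeGen F v.

(* When [1 < level v] every element of [S(v)] has positive level, so that the
   sum in [B_rel_sum] runs over the whole of [S(v)]. *)
Variant B_rel : FV -> Prop :=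
| B_rel_edge (u v : posV) :
    ~~ adj (val u) (val v) -> B_rel (var u * var v)
| B_rel_sum (v : posV) :
    (1 < level (val v))%N ->
    B_rel (var v * \sum_(w : posV | adj (val v) (val w)) var w).

Fact B_rel_proper : ~ in_ideal B_rel 1.
Proof.
pose M := {malg F[{fmonom posV}]}.
pose aug (p : FV) : F := mcoeff mone (p : M).
have augM (p q : FV) : aug (p * q) = aug p * aug q.
  exact: (rmorphM (mcoeff mone : {rmorphism M -> F})).
have aug_sum (s : seq (FV * FV * FV)) f :
    aug (\sum_(t <- s) f t) = \sum_(t <- s) aug (f t).
  exact: (raddf_sum (mcoeff mone : {rmorphism M -> F})).
have aug_var v : aug (var v) = 0.
  by rewrite /aug mcoeffU1 -fdeg_eq0 fdegU.
case=> s sP /(congr1 aug); rewrite aug_sum big_seq big1 => [|t /sP tP].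
  by move/eqP; rewrite /aug mcoeff1 eqxx oner_eq0.
suff rel0 : aug t.1.2 = 0 by rewrite !augM rel0 mulr0 mul0r.
by case: tP => [u v _|v _]; rewrite augM aug_var mul0r.
Qed.

Definition B : algType F := quotAlg B_rel_proper.

Definition B_gen (v : posV) : B := quot_pi B_rel_proper (var v).

Definition B_graded (n : nat) : B -> Prop := graded_part B_gen n.

End AlgebraB.

Arguments B_graded F {N} G n _.

(* Main.v *)
From HB Require Import structures.
Require Import Defs.
From mathcomp Require Import all_boot all_order all_algebra.
From mathcomp Require Import boolp.
From mathcomp Require Import finmap monalg.
From mathcomp Require Import zify.

Set Implicit Arguments.
Unset Strict Implicit.
Unset Printing Implicit Defensive.

Import Order.TTheory GRing.Theory.

Local Open Scope ring_scope.

(** Both sides of the formula are presented by the same generators and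
relations, already for each start vertex [a] separately.

A word in the generators of [B] vanishes unless it is a path of the graph, so
[B_(k+1)] is spanned by the paths [a = v_0 -> v_1 -> ... -> v_k] inside the
positive levels.  The remaining relations say that, for every position [j > 0]
and all fixed [v_i] with [i <> j], the sum over all [v_j] which complete the
path is zero.  On the other side, the poset of [lower_graph a k.+1] occupies
only the [k] levels below [a], so a chain of [k] elements meets each of these
levels once; listed downwards it is exactly a path [v_1 -> ... -> v_k] that can
be prefixed by [a].  No chain is longer, hence every [k]-element cochain is a
cocycle and the top cohomology is the space of these cochains modulo
coboundaries.  The coboundaries are spanned by the coboundaries of the dual
cochains of [(k-1)]-element chains; such a chain misses one level, and the
coboundary of its dual cochain is, up to sign, the sum of the chains that fill
this level: again the relation above.

Two linear maps make this precise.  [paths_of] sends a cochain to the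
corresponding combination of words starting at [a], and [cochain_of] reads the
coefficients of these words off an element of the free algebra.  [paths_of] is
a section of [cochain_of] ([paths_ofK]), and on words of length [k+1] starting
at [a] also its inverse modulo the ideal ([monom_path_retract]); coboundaries are sent into the ideal
([paths_of_coboundary]) and the ideal into coboundaries ([cochain_of_ideal]).
Both inclusions rest on the single identity [cochain_of_relation].  So the
top cohomologies of all vertices [a] above level [k], realized as complements
of the coboundaries, form a direct sum decomposition of [B_(k+1)], and
[has_dim_direct_sum] adds up their dimensions. *)

(** * Dimension of a direct sum *)

Lemma has_dim_finType (F : fieldType) (W : lmodType F) (S : W -> Prop)
    (I : finType) (b : I -> W) :
    (forall x, S x <-> exists c : I -> F, x = \sum_i c i *: b i) ->
    (forall c : I -> F, \sum_i c i *: b i = 0 -> forall i, c i = 0) ->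
  has_dim S #|I|.
Proof.
move=> spanb freeb; exists (b \o enum_val); split=> [x | c c0 i].
  rewrite spanb; split=> -[c ->]; [exists (c \o enum_val) | exists (c \o enum_rank)].
    by rewrite (reindex _ (onW_bij _ (enum_val_bij I))).
  rewrite [RHS](reindex _ (onW_bij _ (enum_val_bij I))).
  by apply: eq_bigr => j _; rewrite /= enum_valK.
rewrite -[i]enum_valK.
apply: (freeb (c \o enum_rank)).
rewrite (reindex _ (onW_bij _ (enum_val_bij I))) -[RHS]c0.
by apply: eq_bigr => j _; rewrite /= enum_valK.
Qed.

(** The summands are the images of the subspaces [H i] under the maps [f i]; a
basis is obtained by collecting the images of bases of all the [H i]. *)
Lemma has_dim_direct_sum (F : fieldType) (W : lmodType F) (S : W -> Prop)
    (I : finType) (V : I -> vectType F) (H : forall i, {vspace V i})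
    (f : forall i, {linear V i -> W}) :
    (forall x, S x <-> exists h : forall i, V i,
       (forall i, h i \in H i) /\ x = \sum_i f i (h i)) ->
    (forall h : forall i, V i, (forall i, h i \in H i) ->
       \sum_i f i (h i) = 0 -> forall i, h i = 0) ->
  has_dim S (\sum_i \dim (H i)).
Proof.
move=> spanS directS.
pose J : finType := {i : I & 'I_(\dim (H i))}.
pose b (j : J) : W := f (tag j) (vbasis (H (tag j)))`_(tagged j).
have -> : (\sum_i \dim (H i))%N = #|J|.
  rewrite card_tagged sumnE big_map big_enum /=.
  by apply: eq_bigr => i _; rewrite card_ord.
have sumJ (c : J -> F) :
    \sum_j c j *: b j = \sum_i f i (\sum_(l < \dim (H i))
      c (Tagged (fun i => 'I_(\dim (H i))) l) *: (vbasis (H i))`_l).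
  rewrite [RHS](eq_bigr (fun i => \sum_(l < \dim (H i))
     c (Tagged (fun i => 'I_(\dim (H i))) l) *: f i (vbasis (H i))`_l)).
    by rewrite sig_big_dep; apply: eq_bigr => -[].
  by move=> i _; rewrite linear_sum; apply: eq_bigr => l _; rewrite linearZ.
have combH (c : J -> F) i : \sum_(l < \dim (H i))
    c (Tagged (fun i => 'I_(\dim (H i))) l) *: (vbasis (H i))`_l \in H i.
  apply: memv_suml => l _; apply: memvZ.
  by apply: vbasis_mem; rewrite mem_nth ?size_tuple.
apply: (has_dim_finType (b := b)) => [x | c].
  rewrite spanS; split=> [[h [hH ->]] | [c ->]].
    exists (fun j => coord (vbasis (H (tag j))) (tagged j) (h (tag j))).
    by rewrite sumJ; apply: eq_bigr => i _; rewrite {1}(coord_vbasis (hH i)).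
  by rewrite sumJ; eexists; split; last by []; exact: combH.
rewrite sumJ => /(directS _ (combH c)) c0 [i l].
have /freeP free_i := basis_free (vbasisP (H i)).
exact: (free_i (fun l => c (Tagged (fun i => 'I_(\dim (H i))) l)) (c0 i) l).
Qed.

(** * Cochains as functions on chains *)

Section Cochains.
Context (F : fieldType) {disp : Order.disp_t} (P : finPOrderType disp).

Definition cochain_fun n (g : chain P n -> F) (c : Cchain F P n) : F^o :=
  \sum_s (c : {ffun _ -> F^o}) s * g s.

Fact cochain_fun_is_linear n (g : chain P n -> F) : linear (cochain_fun g).
Proof.
move=> k c c'; rewrite /cochain_fun scaler_sumr -big_split.
by apply: eq_bigr => s _; rewrite !ffunE /= mulrDl -mulrA.
Qed.
HB.instance Definition _ n (g : chain P n -> F) :=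
  GRing.isLinear.Build F (Cchain F P n) F^o _ (cochain_fun g)
    (cochain_fun_is_linear g).

Definition cochain n (g : chain P n -> F) : Cochain F P n :=
  linfun (cochain_fun g).

(** The value is stated in [F], although cochains take theirs in the module
[F^o], so that the ring operations of [F] apply to it. *)
Definition cval n (f : Cochain F P n) (s : chain P n) : F :=
  f (basis_chain F s).

Lemma cvalE n (g : chain P n -> F) s : cval (cochain g) s = g s.
Proof.
rewrite /cval lfunE /= /cochain_fun (bigD1 s) //= ffunE eqxx mul1r.
by rewrite big1 ?addr0 // => t /negPf ts; rewrite ffunE ts mul0r.
Qed.

Lemma cval0 n s : cval (0 : Cochain F P n) s = 0.
Proof. by rewrite /cval zero_lfunE. Qed.

Lemma cvalD n (f g : Cochain F P n) s : cval (f + g) s = cval f s + cval g s.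
Proof. by rewrite /cval add_lfunE. Qed.

Lemma cvalZ n c (f : Cochain F P n) s : cval (c *: f) s = c * cval f s.
Proof. by rewrite /cval scale_lfunE. Qed.

Lemma cval_sum n (I : Type) (r : seq I) (A : pred I) (f : I -> Cochain F P n) s :
  cval (\sum_(i <- r | A i) f i) s = \sum_(i <- r | A i) cval (f i) s.
Proof.
by apply: (big_morph (fun f => cval f s)) => [g h|]; [exact: cvalD | exact: cval0].
Qed.

Lemma cvalP n (f g : Cochain F P n) : (forall s, cval f s = cval g s) -> f = g.
Proof.
move=> eq_fg; apply/lfunP => c.
have -> : c = \sum_s (c : {ffun _ -> F^o}) s *: basis_chain F s.
  apply/ffunP => t; rewrite sum_ffunE (bigD1 t) //= !ffunE eqxx.
  rewrite [_ *: _]mulr1 big1 ?addr0 // => s /negPf ts.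
  by rewrite !ffunE eq_sym ts; exact: mulr0.
rewrite !linear_sum; apply: eq_bigr => s _; rewrite !linearZ /=.
by congr (_ *: _); exact: eq_fg.
Qed.

Lemma cval_cobd n (f : Cochain F P n) (s : chain P n.+1) :
  cval (cobd F P n f) s = \sum_(l < n.+1) (-1) ^+ l * cval f (face l s).
Proof.
rewrite /cval lfunE /= comp_lfunE lfunE /= /bd_fun (bigD1 s) //= [X in _ + X]big1.
  rewrite addr0 ffunE eqxx scale1r linear_sum.
  by apply: eq_bigr => l _; rewrite linearZ.
by move=> t /negPf ts; rewrite ffunE ts scale0r.
Qed.

(** With [take] and [drop] in place of the indices of [lift], faces commute
with maps and concatenations of sequences. *)
Lemma val_face n (l : 'I_n.+1) (s : chain P n.+1) :
  val (val (face l s)) = take l (val s) ++ drop l.+1 (val s) :> seq P.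
Proof.
set x0 := tnth (val s) ord0.
have size_s : size (val s) = n.+1 by rewrite size_tuple.
have size_l : size (take l (val s)) = l by rewrite size_takel // size_s ltnW.
apply: (@eq_from_nth _ x0) => [|i].
  by rewrite size_tuple size_cat size_l size_drop size_s; case: l {size_l} => l /=; lia.
rewrite size_tuple => lt_in.
rewrite -(tnth_nth x0 (del l (val s)) (Ordinal lt_in)) tnth_mktuple (tnth_nth x0).
rewrite nth_cat size_l /= /bump; case: ltnP => [lt_il | le_li].
  by rewrite nth_take // leqNgt lt_il.
by rewrite nth_drop; congr nth; lia.
Qed.

Lemma cohomology_coboundary0 n (f : Cochain F P n) :
  f \in cohomology F P n -> f \in coboundaries F P n -> f = 0.
Proof.
move=> Hf Bf; apply/eqP.
rewrite -memv0 -(capv_diff (cocycles F P n) (coboundaries F P n)).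
by rewrite memv_cap Hf.
Qed.

(** In top degree there is nothing to map to, so every cochain is a cocycle. *)
Lemma mem_top_cochain n (f : Cochain F P n) : (chain P n.+1 -> False) ->
  f \in (cohomology F P n + coboundaries F P n)%VS.
Proof.
move=> no_chain; rewrite addv_diff; apply: (subvP (addvSl _ _)).
by rewrite memv_ker; apply/eqP/cvalP => s; case: (no_chain s).
Qed.

End Cochains.

(** * Words and their coefficients in the free algebra *)

Section Words.
Context (F : fieldType) {N : nat} (G : layeredGraph N).
Local Notation FV := (FV F G).
Local Notation in_idl := (in_ideal (@B_rel F N G)).
Local Notation M := {malg F[{fmonom (posV G)}]}.

Definition monom (w : seq (posV G)) : FV := << FMonom w >> : M.

Definition word_coef (w : seq (posV G)) (p : FV) : F := mcoeff (FMonom w) (p : M).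

Fact word_coef_is_linear w : linear_for *%R (word_coef w).
Proof.
move=> k p q; rewrite /word_coef.
by rewrite [LHS](mcoeffD (FMonom w) (k *: p : M) (q : M)) (mcoeffZ k (p : M)).
Qed.
HB.instance Definition _ w :=
  GRing.isLinear.Build F FV F *%R (word_coef w) (word_coef_is_linear w).

Lemma word_coefZ w c p : word_coef w (c *: p) = c * word_coef w p.
Proof. exact: linearZ. Qed.

Lemma word_coef_sum w (I : Type) (r : seq I) (A : pred I) (p : I -> FV) :
  word_coef w (\sum_(i <- r | A i) p i) = \sum_(i <- r | A i) word_coef w (p i).
Proof. exact: linear_sum. Qed.

Lemma word_coef_monom w u : word_coef w (monom u) = (u == w)%:R.
Proof. by rewrite /word_coef mcoeffU1. Qed.

Lemma monom1 v : var F v = monom [:: v].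
Proof. by rewrite /var /freeGen /monom fmuE. Qed.

Lemma monomM u w : monom u * monom w = monom (u ++ w).
Proof.
rewrite /monom.
have -> : FMonom (u ++ w) = mmul (FMonom u) (FMonom w).
  by rewrite /mmul /= fmmulE.
by rewrite [LHS]malgM_def fgmulUU mulr1.
Qed.

Lemma monom_sum (p : FV) : exists s : seq (seq (posV G)),
  p = \sum_(w <- s) word_coef w p *: monom w.
Proof.
exists [seq fmonom_val m | m <- enum_fset (msupp (p : M))].
rewrite [LHS](monalgE (p : M)) big_map; apply: eq_bigr => -[w] _.
apply/malgP => m; rewrite mcoeffU [RHS](mcoeffZ _ (monom w : M)).
by rewrite mcoeffU1 mulr_natr.
Qed.

Lemma monom_prod w : monom w = \prod_(v <- w) var F v.
Proof.
elim: w => [|v w IHw]; last by rewrite big_cons -IHw monom1 monomM.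
rewrite big_nil.
apply/malgP => m; rewrite mcoeffU1 [RHS]mcoeff1.
by rewrite -(fmoneE (posV G)) eq_sym.
Qed.

(** By bilinearity it is enough to multiply the relations by words. *)
Lemma ideal_monomial_ind (C : FV -> Prop) :
    C 0 -> (forall p q, C p -> C q -> C (p + q)) ->
    (forall k p, C p -> C (k *: p)) ->
    (forall u r w, B_rel r -> C (monom u * r * monom w)) ->
  forall p, in_idl p -> C p.
Proof.
move=> C0 CD CZ Crel _ [s rel_s ->]; rewrite big_seq.
apply: big_ind => // -[[x r] y] /rel_s /= rel_r.
(* Multiplication unfolds to a sum over words, so each factor to expand is
   designated explicitly. *)
have [su ->] := monom_sum x; have [sw ->] := monom_sum y.
rewrite [X in X * _]mulr_suml mulr_suml; apply: big_ind => // u _.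
rewrite mulr_sumr; apply: big_ind => // w _.
by rewrite -scalerAl -scalerAr -scalerAl scalerA; apply: CZ; apply: Crel.
Qed.

Lemma mem_idealP p : reflect (in_idl p) (p \in ideal (@B_rel F N G)).
Proof. exact: asboolP. Qed.

Lemma in_ideal0 : in_idl 0.
Proof. by apply/mem_idealP; exact: rpred0. Qed.

Lemma in_ideal_rel r : B_rel r -> in_idl r.
Proof.
move=> rel_r; exists [:: (1, r, 1)]; last by rewrite big_seq1 mul1r mulr1.
by move=> t; rewrite inE => /eqP->.
Qed.

Lemma in_ideal_monom_nonpath (w : seq (posV G)) :
  ~~ sorted (@adj N G) (map val w) -> in_idl (monom w).
Proof.
elim: w => [/negP[]|u [_ /negP[]|v w IHw]]; rewrite ?isT //.
rewrite [sorted _ _]/= negb_and.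
have [uv /= /IHw | uv _] := boolP (adj (val u) (val v)).
  have -> : monom (u :: v :: w) = monom [:: u] * monom (v :: w).
    by rewrite monomM.
  by move=> /mem_idealP/(Defs.idealMl (monom [:: u]))/mem_idealP.
have -> : monom (u :: v :: w) = (var F u * var F v) * monom w.
  by rewrite !monom1 !monomM.
apply/mem_idealP; apply: Defs.idealMr.
by apply/mem_idealP/in_ideal_rel/B_rel_edge.
Qed.

Lemma relation_monom m1 (v : posV G) m2 :
  monom m1 * (var F v * \sum_(w : posV G | adj (val v) (val w)) var F w) *
    monom m2 =
  \sum_(w : posV G | adj (val v) (val w)) monom (m1 ++ v :: w :: m2).
Proof.
rewrite [var F v * _]mulr_sumr [monom m1 * _]mulr_sumr mulr_suml.
apply: eq_bigr => w _; rewrite !monom1 !monomM; congr monom.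
by rewrite -catA.
Qed.

(** For [v] at level 1 this is the empty sum: the generators have positive
level. *)
Lemma relation_in_ideal m1 (v : posV G) m2 :
  in_idl (\sum_(w : posV G | adj (val v) (val w)) monom (m1 ++ v :: w :: m2)).
Proof.
have [gt1v | le1v] := ltnP 1 (level (val v)).
  rewrite -relation_monom; apply/mem_idealP.
  apply: Defs.idealMr; apply: Defs.idealMl.
  by apply/mem_idealP/in_ideal_rel/B_rel_sum.
rewrite big1; first exact: in_ideal0.
move=> w /level_adj lev_v; move: le1v (valP w).
by rewrite lev_v ltnS leqn0 => /eqP->.
Qed.

End Words.

(** * Top chains below a vertex are paths *)

Lemma sorted_consecutive (T : Type) (e : rel T) s1 x y s2 :
  sorted e (s1 ++ x :: y :: s2) -> e x y.
Proof.
by case: s1 => [|z s1] /=; [case/andP | rewrite cat_path /= => /and4P[]].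
Qed.

Section Paths.
Context {N : nat} (G : layeredGraph N).
Local Notation V := (vertex G).

Lemma below_trans (v u w : V) : below w v -> below v u -> below w u.
Proof.
rewrite [below w v]belowE => /andP[_ vw] /existsP[x /andP[ux xv]].
by apply/existsP; exists x; rewrite ux (connect_trans xv vw).
Qed.

Lemma adj_below (u v : V) : adj u v -> below v u.
Proof. by move=> uv; apply/existsP; exists v; rewrite uv connect0. Qed.

Lemma below_adj (u v : V) : below v u -> level u = (level v).+1 -> adj u v.
Proof.
case/existsP=> w /andP[uw wv] lev; have := level_adj uw; rewrite lev => -[lev_vw].
have [<- //|neq_wv] := eqVneq w v.
have /level_below : below v w by rewrite belowE neq_wv.
by rewrite lev_vw ltnn.
Qed.

End Paths.

Section LowerGraph.
Context {N : nat} (G : layeredGraph N).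
Local Notation V := (vertex G).
Variables (a : V) (k : nat).
Local Notation L := (lower_graph a k.+1).
Local Notation P := (vposet L).

Definition vertex_of (x : P) : V :=
  val (x : ivertex [set w | below w a && (level a - level w <= k.+1 - 1)%N]).

Lemma vertex_of_inj : injective vertex_of. Proof. exact: val_inj. Qed.

Lemma vertex_of_below x : below (vertex_of x) a.
Proof. by have := valP (x : ivertex _); rewrite inE => /andP[]. Qed.

Lemma vertex_of_level x : (level a - k <= level (vertex_of x) < level a)%N.
Proof.
rewrite (level_below (vertex_of_below x)) andbT.
have := valP (x : ivertex _); rewrite inE -/(vertex_of x) => /andP[_]; lia.
Qed.

Lemma vertex_of_onto v :
  below v a -> (level a - k <= level v)%N -> exists x, vertex_of x = v.
Proof.
move=> va lv.
have Av : v \in [set w | below w a & (level a - level w <= k.+1 - 1)%N].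
  by rewrite inE va /=; lia.
by exists (exist _ v Av).
Qed.

Lemma adj_vertex_of (x y : P) :
  adj (x : vertex L) (y : vertex L) = adj (vertex_of x) (vertex_of y).
Proof.
apply/existsP/existsP => -[e /andP[/eqP te /eqP he]].
  by exists (val e); rewrite -te -he !eqxx.
pose A := [set w | below w a && (level a - level w <= k.+1 - 1)%N].
have Ae : (tail e \in A) && (Defs.head e \in A).
  rewrite te he; apply/andP.
  by split; [exact: (valP (x : ivertex A)) | exact: (valP (y : ivertex A))].
exists (exist _ e Ae : iedge _); apply/andP; split; apply/eqP/vertex_of_inj.
  by rewrite -te.
by rewrite -he.
Qed.

Lemma lt_vertex_of (x y : P) : (x < y)%O -> below (vertex_of x) (vertex_of y).
Proof.
case/existsP=> w /andP[yw /connectP[q wq x_last]].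
apply/existsP; exists (vertex_of w); rewrite -adj_vertex_of yw /=.
apply/connectP; exists (map vertex_of q); last by rewrite x_last last_map.
by rewrite path_map; apply: sub_path wq => u v /=; rewrite adj_vertex_of.
Qed.

Lemma adj_lt (x y : P) : adj (vertex_of y) (vertex_of x) -> (x < y)%O.
Proof. by rewrite -adj_vertex_of => yx; exact: (@adj_below). Qed.

(** The chain in increasing order, topped by [a]: the reverse of the path that
it stands for. *)
Definition ascent n (s : chain P n) : seq V := rcons (map vertex_of (val s)) a.

Lemma size_ascent n (s : chain P n) : size (ascent s) = n.+1.
Proof. by rewrite size_rcons size_map size_tuple. Qed.

Lemma ascent_inj n : injective (@ascent n).
Proof.
move=> s t /rcons_inj[/(inj_map vertex_of_inj) eq_st].
by apply/val_inj/val_inj.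
Qed.

Lemma ascent_sorted n (s : chain P n) : sorted (@below N G) (ascent s).
Proof.
have: sorted (@below N G) (map vertex_of (val s)).
  by apply: homo_sorted (valP s) => x y; exact: lt_vertex_of.
have: all (fun v => below v a) (map vertex_of (val s)).
  by rewrite all_map; apply/allP => x _; exact: vertex_of_below.
rewrite /ascent; case: (map _ _) => //= v q /andP[va qa] v_q.
rewrite rcons_path v_q /=; case: (lastP q) qa => //= q' w.
by rewrite all_rcons last_rcons => /andP[].
Qed.

Lemma ascent_level_sorted n (s : chain P n) :
  sorted ltn (map (@level N G) (ascent s)).
Proof. by apply: homo_sorted (ascent_sorted s) => u v; exact: level_below. Qed.

(** Along a path of [k] edges down from [a] the level drops by one at each
step, so the path never leaves the poset. *)
Lemma ascent_onto (q : seq V) : sorted (fun v u => adj u v) (rcons q a) ->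
  size q = k -> exists s : chain P k, ascent s = rcons q a.
Proof.
move=> q_adj size_q.
(* The bound [level v + size q] is loose inside [q]; it is the form that is
   stable under removing the bottom of the path. *)
have q_range : {in q, forall v, below v a /\ (level a <= level v + size q)%N}.
  elim: q q_adj {size_q} => //= v q IHq vq w.
  have {}IHq := IHq (path_sorted vq).
  rewrite inE => /predU1P[-> {w}|/IHq[wa]]; last by split=> //; lia.
  case: q vq IHq => [|u q] /= /andP[uv _] IHq.
    by rewrite (level_adj uv); split; [exact: adj_below | lia].
  have [|ua la] := IHq u; first exact: mem_head.
  split; first exact: below_trans (adj_below uv) ua.
  by rewrite (level_adj uv) in la; lia.
have [xs def_q] : exists xs : seq P, map vertex_of xs = q.
  rewrite {}size_q in q_range; elim: q q_range {q_adj} => [|v q IHq] q_range.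
    by exists [::].
  have [|va lv] := q_range v; first exact: mem_head.
  have [|x def_v] := vertex_of_onto va; first lia.
  have [w qw|xs def_q] := IHq; first by apply: q_range; rewrite inE qw orbT.
  by exists (x :: xs); rewrite /= def_v def_q.
have size_xs : size xs == k by rewrite -(size_map vertex_of) def_q size_q.
have lt_xs : sorted <%O (Tuple size_xs).
  have : sorted (fun v u => adj u v) (map vertex_of xs).
    by rewrite def_q; case: (q) q_adj => //= v r; rewrite rcons_path => /andP[].
  by rewrite sorted_map; apply: sub_sorted => x y; exact: adj_lt.
by exists (exist _ (Tuple size_xs) lt_xs); rewrite /ascent /= def_q.
Qed.

(** The top vertex [a] is never removed: it comes after all the points of the
chain. *)
Lemma ascent_face n (l : 'I_n.+1) (s : chain P n.+1) :
  ascent (face l s) = take l (ascent s) ++ drop l.+1 (ascent s).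
Proof.
have size_s : size (map vertex_of (val s)) = n.+1 by rewrite size_map size_tuple.
rewrite /ascent val_face map_cat map_take map_drop -!cats1 -catA.
rewrite take_cat drop_cat size_s ltn_ord; case: ltnP => // le_nl.
have -> : (l.+1 - n.+1)%N = 0%N by case: (l) le_nl => l' /=; lia.
by rewrite drop_oversize ?size_s.
Qed.

Hypothesis lt_ka : (k < level a)%N.

(** Levels increase strictly along [ascent s] and take at most [k.+1] values;
a chain of [k] elements therefore uses each value exactly once. *)
Lemma ascent_level_range n (s : chain P n) :
  {subset map (@level N G) (ascent s) <= iota (level a - k) k.+1}.
Proof.
move=> _ /mapP[v + ->]; rewrite mem_iota mem_rcons inE => /predU1P[->|]; first lia.
by case/mapP=> x _ ->; have := vertex_of_level x; lia.
Qed.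

Lemma no_long_chain : chain P k.+1 -> False.
Proof.
move=> s; have := uniq_leq_size (sorted_uniq ltn_trans ltnn (ascent_level_sorted s))
  (@ascent_level_range _ s).
by rewrite size_map size_ascent size_iota ltnn.
Qed.

Lemma ascent_level (s : chain P k) :
  map (@level N G) (ascent s) = iota (level a - k) k.+1.
Proof.
apply: (irr_sorted_eq ltn_trans ltnn (ascent_level_sorted s) (iota_ltn_sorted _ _)).
have [|//] := uniq_min_size (sorted_uniq ltn_trans ltnn (ascent_level_sorted s))
  (@ascent_level_range _ s).
by rewrite size_map size_ascent size_iota.
Qed.

(** Comparable vertices at adjacent levels are joined by an edge. *)
Lemma ascent_adj (s : chain P k) : sorted (fun v u => adj u v) (ascent s).
Proof.
have := ascent_sorted s; have := ascent_level s.
elim: (ascent s) (level a - k)%N (k.+1) => // v [//|u q] IHq m [|[|l]] //=.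
case=> lv lu lq /andP[vu uq].
by rewrite below_adj //= ?lu ?lv //; apply: (IHq m.+1 l.+1) => //=; rewrite lu lq.
Qed.

End LowerGraph.

(** * The exchange between cochains and words *)

Section PathWords.
Context (F : fieldType) {N : nat} (G : layeredGraph N) (k : nat).
Local Notation V := (vertex G).
Local Notation P a := (vposet (lower_graph a k.+1)).
Local Notation in_idl := (in_ideal (@B_rel F N G)).

(** The partial injection [insub] into the positive vertices drops nothing
once [k < level a]. *)
Definition path_word a n (s : chain (P a) n) : seq (posV G) :=
  pmap insub (rev (ascent s)).

Definition cochain_of a (p : FV F G) : Cochain F (P a) k :=
  cochain (fun s => word_coef (path_word s) p).

Fact cochain_of_is_linear a : linear (cochain_of a).
Proof.
move=> c p q; apply: cvalP => s.
by rewrite cvalD cvalZ !cvalE linearP.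
Qed.
HB.instance Definition _ a :=
  GRing.isLinear.Build F (FV F G) (Cochain F (P a) k) _ (cochain_of a)
    (cochain_of_is_linear a).

Definition paths_of a (f : Cochain F (P a) k) : FV F G :=
  \sum_s cval f s *: monom F (path_word s).

Fact paths_of_is_linear a : linear (@paths_of a).
Proof.
move=> c f g; rewrite /paths_of scaler_sumr -big_split; apply: eq_bigr => s _.
by rewrite cvalD cvalZ scalerDl scalerA.
Qed.
HB.instance Definition _ a :=
  GRing.isLinear.Build F (Cochain F (P a) k) (FV F G) _ (@paths_of a)
    (@paths_of_is_linear a).

Section HighVertex.
Variables (a : V) (lt_ka : (k < level a)%N).

Lemma ascent_pos n (s : chain (P a) n) v : v \in ascent s -> (0 < level v)%N.
Proof.
move=> sv; have := @ascent_level_range _ G a k lt_ka _ s (level v).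
by rewrite map_f // mem_iota => /(_ isT); lia.
Qed.

Lemma val_path_word n (s : chain (P a) n) :
  map val (path_word s) = rev (ascent s).
Proof.
rewrite (pmap_filter (insubK _)); apply/all_filterP/allP => v.
by rewrite mem_rev => /ascent_pos v_gt0; rewrite isSome_insub.
Qed.

Lemma path_wordP n (s : chain (P a) n) w :
  (w == path_word s) = (ascent s == rev (map val w)).
Proof.
rewrite -(inj_eq (inj_map val_inj)) val_path_word.
by rewrite -(inj_eq (can_inj revK)) revK eq_sym.
Qed.

Lemma size_path_word n (s : chain (P a) n) : size (path_word s) = n.+1.
Proof. by rewrite -(size_map val) val_path_word size_rev size_ascent. Qed.

Lemma path_word_inj n : injective (@path_word a n).
Proof.
move=> s t eq_st; apply: ascent_inj; apply: (can_inj revK).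
by rewrite -!val_path_word eq_st.
Qed.

Lemma path_word_adj (s : chain (P a) k) : sorted (@adj N G) (map val (path_word s)).
Proof. by rewrite val_path_word rev_sorted ascent_adj. Qed.

Lemma path_word_head n (s : chain (P a) n) : ohead (map val (path_word s)) = Some a.
Proof. by rewrite val_path_word rev_rcons. Qed.

Lemma path_word_onto (w : seq (posV G)) :
    ohead (map val w) = Some a -> size w = k.+1 -> sorted (@adj N G) (map val w) ->
  exists s : chain (P a) k, w = path_word s.
Proof.
case: w => //= v w [def_a] [size_w] vw.
have [||s def_s] := @ascent_onto _ G a k (rev (map val w)).
- by rewrite -def_a -rev_cons rev_sorted.
- by rewrite size_rev size_map.
by exists s; apply/eqP; rewrite path_wordP def_s /= rev_cons def_a.
Qed.

Lemma paths_ofK : cancel (@paths_of a) (cochain_of a).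
Proof.
move=> f; apply: cvalP => s; rewrite cvalE word_coef_sum.
rewrite (eq_bigr (fun t => cval f t * (t == s)%:R)) => [|t _]; last first.
  by rewrite word_coefZ word_coef_monom (inj_eq (@path_word_inj k)).
by rewrite (bigD1 s) //= eqxx mulr1 big1 ?addr0 // => t /negPf->; rewrite mulr0.
Qed.

(** A word starting at [a] is either a path, hence the word of a chain, or it
is zero on both sides modulo the ideal. *)
Lemma monom_path_retract (w : seq (posV G)) :
    ohead (map val w) = Some a -> size w = k.+1 ->
  in_idl (monom F w - paths_of (cochain_of a (monom F w))).
Proof.
move=> w_head size_w; have [w_adj|w_nonadj] := boolP (sorted (@adj N G) (map val w)).
  have [s ->] := path_word_onto w_head size_w w_adj.
  rewrite /paths_of (bigD1 s) //= cvalE word_coef_monom eqxx scale1r.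
  rewrite big1 => [|t /negPf ts].
    by rewrite addr0 subrr; exact: in_ideal0.
  by rewrite cvalE word_coef_monom (inj_eq (@path_word_inj k)) eq_sym ts scale0r.
suff -> : cochain_of a (monom F w) = 0.
  by rewrite linear0 subr0; exact: in_ideal_monom_nonpath.
apply: cvalP => s; rewrite cvalE word_coef_monom cval0.
by have [eq_w|//] := eqVneq; rewrite eq_w path_word_adj in w_nonadj.
Qed.

End HighVertex.

Lemma cochain_of_other a b w : (k < level b)%N ->
  ohead (map val w) = Some a -> a != b -> cochain_of b (monom F w) = 0.
Proof.
move=> lt_kb w_head neq_ab; apply: cvalP => s.
rewrite cvalE word_coef_monom cval0.
have [eq_w|//] := eqVneq; move: w_head; rewrite eq_w path_word_head // => -[eq_ba].
by rewrite eq_ba eqxx in neq_ab.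
Qed.

Lemma paths_of_other a b (f : Cochain F (P a) k) :
  (k < level a)%N -> (k < level b)%N -> a != b ->
  cochain_of b (paths_of f) = 0.
Proof.
move=> lt_ka lt_kb neq_ab; rewrite linear_sum big1 // => s _.
by rewrite linearZ /= (@cochain_of_other a) ?scaler0 ?path_word_head.
Qed.

End PathWords.

(** * Relations of the algebra are coboundaries *)

Section Relations.
Context (F : fieldType) {N : nat} (G : layeredGraph N).
Local Notation V := (vertex G).
Local Notation in_idl := (in_ideal (@B_rel F N G)).

Lemma sum_level_ascent_face n (a : V) (lt_na : (n.+1 < level a)%N)
    (s : chain (vposet (lower_graph a n.+2)) n.+1) (l : 'I_n.+1) :
  (sumn (map (@level N G) (ascent (face l s))) + (level a - n.+1 + l) =
   sumn (iota (level a - n.+1) n.+2))%N.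
Proof.
rewrite ascent_face map_cat map_take map_drop (ascent_level lt_na).
set L := iota _ _; rewrite sumn_cat -[in RHS](cat_take_drop l L) sumn_cat.
have lt_l : (l < n.+2)%N by apply: ltnW; rewrite ltnS.
have -> : drop l L = (level a - n.+1 + l)%N :: drop l.+1 L.
  by rewrite (drop_nth 0%N) ?size_iota // nth_iota.
by rewrite -[sumn (_ :: _)]/(_ + sumn _)%N; lia.
Qed.

(** The face of a top chain remembers which level it misses, because all top
chains have the same levels: the sum of the levels of the face determines the
missing one. *)
Lemma face_index_inj n (a : V) (lt_na : (n.+1 < level a)%N)
    (s t : chain (vposet (lower_graph a n.+2)) n.+1) (l m : 'I_n.+1) :
  face l s = face m t -> l = m.
Proof.
move=> eq_st; have := sum_level_ascent_face lt_na s l.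
rewrite eq_st -(sum_level_ascent_face lt_na t m) => eq_lm.
by apply: val_inj => /=; lia.
Qed.

Section Top.
Variables (n : nat) (a : V) (lt_na : (n.+1 < level a)%N).
Local Notation P := (vposet (lower_graph a n.+2)).

Definition dual_cochain (t : chain P n) : Cochain F P n :=
  cochain (fun t' => (t' == t)%:R).

Lemma cval_dual_cochain t t' : cval (dual_cochain t) t' = (t' == t)%:R.
Proof. exact: cvalE. Qed.

(** The relation that sums over the vertex after [v] reads off, on a top chain
[s], whether [s] passes through [m1], [v] and [m2], that is, whether its face
without the level below [v] equals that of [s0].  In the coboundary only this
face can contribute, since the index of the face is determined
([face_index_inj]).  As chains increase while words descend, the omitted vertex
has as many vertices below it as [m2] has letters. *)
Lemma cochain_of_relation m1 (v w0 : posV G) m2 (s0 : chain P n.+1) (l : 'I_n.+1) :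
    path_word s0 = m1 ++ v :: w0 :: m2 -> size m2 = l ->
  cochain_of n.+1 a
    (\sum_(w : posV G | adj (val v) (val w)) monom F (m1 ++ v :: w :: m2)) =
  (-1) ^+ l *: cobd F P n (dual_cochain (face l s0)).
Proof.
move=> def_s0 size_m2.
pose A := rev (map val m2); pose C := rev (map val (rcons m1 v)).
have size_A : size A = l by rewrite size_rev size_map.
have wordE (s : chain P n.+1) w :
    (m1 ++ v :: w :: m2 == path_word s) = (ascent s == A ++ val w :: C).
  rewrite path_wordP // -cat_rcons map_cat rev_cat -/C /= rev_cons.
  by rewrite -cats1 -catA.
have faceE (s : chain P n.+1) x : ascent s = A ++ x :: C ->
    ascent (face l s) = A ++ C.
  by move=> def_s; rewrite ascent_face def_s -size_A take_size_cat // drop_cat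
    ltnNge leqnSn /= subSnn /= drop0.
have face0 : ascent (face l s0) = A ++ C.
  by apply: (faceE _ (val w0)); apply/eqP; rewrite -wordE def_s0.
apply: cvalP => s; rewrite cvalZ cval_cobd (bigD1 l) //=.
rewrite [X in _ * (_ + X)]big1 => [|m neq_ml]; last first.
  rewrite cval_dual_cochain; case: eqP => [/(face_index_inj lt_na) eq_ml|_].
    by rewrite eq_ml eqxx in neq_ml.
  by rewrite mulr0.
rewrite addr0 mulrA -expr2 sqrr_sign mul1r cvalE cval_dual_cochain word_coef_sum.
have [eq_face | neq_face] := eqVneq.
  have : ascent (face l s) = A ++ C by rewrite eq_face.
  rewrite ascent_face => /eqP; rewrite eqseq_cat; last first.
    by rewrite size_A size_takel // size_ascent; case: (l) => l' /=; lia.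
  case/andP=> /eqP take_s /eqP drop_s.
  have lt_l : (l < size (ascent s))%N.
    by rewrite size_ascent; case: (l) => l' /=; lia.
  pose x := nth a (ascent s) l.
  have def_s : ascent s = A ++ x :: C.
    by rewrite -drop_s -take_s -drop_nth // cat_take_drop.
  have x_gt0 : (0 < level x)%N.
    by apply: (ascent_pos lt_na (s := s)); rewrite mem_nth.
  pose w : posV G := Sub x x_gt0.
  have word_s : m1 ++ v :: w :: m2 = path_word s.
    by apply/eqP; rewrite wordE def_s SubK.
  have vw : adj (val v) (val w).
    have := path_word_adj lt_na s; rewrite -word_s map_cat.
    exact: sorted_consecutive.
  rewrite (bigD1 w) //= word_coef_monom word_s eqxx.
  rewrite big1 ?addr0 // => w' /andP[_ neq_w].
  rewrite word_coef_monom; case: eqP => // /eqP.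
  by rewrite -word_s eqseq_cat // eqxx !eqseq_cons eqxx (negPf neq_w).
rewrite big1 // => w _; rewrite word_coef_monom; case: eqP => // /eqP.
rewrite wordE => /eqP/faceE; rewrite -face0 => /ascent_inj eq_face.
by rewrite eq_face eqxx in neq_face.
Qed.

(** If the chain [t] is a face of a top chain [s], then splitting the word of
[s] around the missing level exhibits the coboundary as the image of a relation
[p]; and modulo the ideal [paths_of] undoes [cochain_of] on [p].  Otherwise the
coboundary is zero. *)
Lemma paths_of_cobd_dual_cochain (t : chain P n) :
  in_idl (paths_of (k := n.+1) (cobd F P n (dual_cochain t))).
Proof.
have [/existsP[l /existsP[s /eqP def_t]] | /existsPn not_face] :=
    boolP [exists l : 'I_n.+1, exists s, face l s == t]; last first.
  have -> : cobd F P n (dual_cochain t) = 0.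
    apply: cvalP => s; rewrite cval_cobd cval0 big1 // => l _.
    have /existsPn/(_ s) /negPf neq_t := not_face l.
    by rewrite cval_dual_cochain neq_t mulr0.
  by rewrite linear0; exact: in_ideal0.
(* The word lists [a] first and then the chain backwards. *)
have size_s := size_path_word lt_na s; pose i := (n.+1 - l)%N.
have lt_l := ltn_ord l.
have size_i : size (take i (path_word s)) = i.
  by rewrite size_takel // size_s; lia.
case def_m1: {1}(take i (path_word s)) / lastP => [|m1 v].
  by have := congr1 size def_m1; rewrite size_i /i /=; lia.
case def_m2: {1}(drop i (path_word s)) => [|w m2].
  by have := congr1 size def_m2; rewrite size_drop size_s /i /=; lia.
have def_s : path_word s = m1 ++ v :: w :: m2.
  by rewrite -(cat_take_drop i (path_word s)) def_m1 def_m2 cat_rcons.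
have size_m2 : size m2 = l.
  by have := congr1 size def_m2; rewrite size_drop size_s /i /=; lia.
set p := \sum_(w' : posV G | adj (val v) (val w')) monom F (m1 ++ v :: w' :: m2).
have retract_p : in_idl (p - paths_of (cochain_of n.+1 a p)).
  apply/mem_idealP; rewrite [cochain_of _ _ p]linear_sum [paths_of _]linear_sum.
  rewrite -sumrB; apply: rpred_sum => w' _.
  apply/mem_idealP/monom_path_retract => //.
    by have := path_word_head lt_na s; rewrite def_s; case: (m1).
  by rewrite -size_s def_s !size_cat.
have -> : cobd F P n (dual_cochain t) = (-1) ^+ l *: cochain_of n.+1 a p.
  by rewrite (cochain_of_relation def_s size_m2) def_t signrZK.
rewrite linearZ /=; apply/mem_idealP/Defs.idealZ.
rewrite -[paths_of _](subKr p).
by apply: rpredB; apply/mem_idealP => //; exact: relation_in_ideal.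
Qed.

End Top.

Lemma paths_of_coboundary k (a : V) (f : Cochain F (vposet (lower_graph a k.+1)) k) :
  (k < level a)%N -> f \in coboundaries F (vposet (lower_graph a k.+1)) k ->
  in_idl (paths_of f).
Proof.
case: k f => [|n] f lt_na.
  by rewrite memv0 => /eqP->; rewrite linear0; exact: in_ideal0.
case/memv_imgP=> g _ ->.
have -> : g = \sum_t cval g t *: dual_cochain t.
  apply: cvalP => s; rewrite cval_sum (bigD1 s) //= cvalZ cval_dual_cochain eqxx mulr1.
  rewrite big1 ?addr0 // => t /negPf ts.
  by rewrite cvalZ cval_dual_cochain eq_sym ts mulr0.
rewrite linear_sum [paths_of _]linear_sum; apply/mem_idealP.
apply: rpred_sum => t _; rewrite linearZ /= [paths_of _]linearZ /=.
by apply/Defs.idealZ/mem_idealP/paths_of_cobd_dual_cochain.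
Qed.

(** A quadratic relation [u * v] only involves words that are not paths.  A sum
relation either involves no path starting at [a], or [cochain_of_relation]
applies to one of the paths occurring in it. *)
Lemma cochain_of_ideal k (a : V) (p : FV F G) : (k < level a)%N -> in_idl p ->
  cochain_of k a p \in coboundaries F (vposet (lower_graph a k.+1)) k.
Proof.
move=> lt_ka; move: p; apply: ideal_monomial_ind => [|p q Cp Cq|c p Cp|m1 r m2].
- by rewrite linear0 mem0v.
- by rewrite linearD memvD.
- by rewrite linearZ memvZ.
case=> [u v not_uv | v _].
  suff -> : cochain_of k a (monom F m1 * (var F u * var F v) * monom F m2) = 0.
    exact: mem0v.
  apply: cvalP => s; rewrite cvalE cval0 !monom1 !monomM word_coef_monom.
  case: eqP => // def_s; have := path_word_adj lt_ka s.
  rewrite -def_s -catA map_cat => /(@sorted_consecutive _ _ _ _ _ _) uv.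
  by rewrite uv in not_uv.
rewrite relation_monom.
have [/existsP[s /existsP[w /eqP def_s]] | no_path] :=
    boolP [exists s : chain (vposet (lower_graph a k.+1)) k,
             exists w, path_word s == m1 ++ v :: w :: m2]; last first.
  suff -> : cochain_of k a (\sum_(w : posV G | adj (val v) (val w))
              monom F (m1 ++ v :: w :: m2)) = 0 by exact: mem0v.
  apply: cvalP => s; rewrite cvalE cval0 word_coef_sum big1 // => w _.
  rewrite word_coef_monom eq_sym.
  by move/existsPn/(_ s)/existsPn/(_ w)/negPf: no_path => ->.
have := size_path_word lt_ka s; rewrite def_s size_cat /= => size_k.
(* The two-letter segment [v], [w] leaves no room for [k = 0]. *)
case: k => [|n] in lt_ka s def_s size_k *; first lia.
have lt_m2 : (size m2 < n.+1)%N.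
  by move: size_k; rewrite !addnS => -[<-]; rewrite ltnS leq_addl.
rewrite (cochain_of_relation lt_ka def_s (l := Ordinal lt_m2)) //.
by apply/memvZ/memv_img/memvf.
Qed.

End Relations.

(** * Graded parts of the algebra as sums of top cohomologies *)

Section Graded.
Context (F : fieldType) {N : nat} (G : layeredGraph N).
Local Notation V := (vertex G).
Local Notation in_idl := (in_ideal (@B_rel F N G)).

Definition toB (p : FV F G) : B F G := quot_pi (B_rel_proper (G := G)) p.

Fact toB_is_linear : linear toB.
Proof. by move=> c p q; rewrite /toB quot_piD quot_piZ. Qed.
HB.instance Definition _ :=
  GRing.isLinear.Build F (FV F G) (B F G) _ toB toB_is_linear.

Lemma toB_eq0 p : toB p = 0 <-> in_idl p.
Proof.
rewrite -(linear0 toB); split=> [/eqP|/mem_idealP idl_p]; last apply/eqP.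
  by rewrite quot_pi_eq subr0 => /mem_idealP.
by rewrite quot_pi_eq subr0.
Qed.

Lemma toB_eq p q : in_idl (p - q) -> toB p = toB q.
Proof. by move/toB_eq0 => eq0; apply/eqP; rewrite -subr_eq0 -linearB /= eq0. Qed.

Lemma toB_monom w : toB (monom F w) = \prod_(v <- w) B_gen F v.
Proof.
elim: w => [|v w IHw]; first by rewrite monom_prod !big_nil.
by rewrite big_cons -IHw -cat1s -monomM -monom1 /toB quot_piM.
Qed.

Lemma B_gradedE n x : B_graded F G n x <->
  exists c : n.-tuple (posV G) -> F, x = toB (\sum_w c w *: monom F w).
Proof.
have sumE (c : n.-tuple (posV G) -> F) : toB (\sum_w c w *: monom F w) =
    \sum_w c w *: \prod_(v <- w) B_gen F v.
  by rewrite linear_sum; apply: eq_bigr => w _; rewrite linearZ -toB_monom.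
by split=> -[c ->]; exists c; rewrite sumE.
Qed.

Section Degree.
Variable k : nat.
Local Notation P a := (vposet (lower_graph a k.+1)).

Definition B_of_cochain (a : V) (f : Cochain F (P a) k) : B F G :=
  toB (paths_of f).

Fact B_of_cochain_is_linear a : linear (@B_of_cochain a).
Proof. by move=> c f g; rewrite /B_of_cochain !linearP. Qed.
HB.instance Definition _ a :=
  GRing.isLinear.Build F (Cochain F (P a) k) (B F G) _ (@B_of_cochain a)
    (@B_of_cochain_is_linear a).

(** Paths of [k] edges inside the positive levels only start above level [k];
the lower vertices, whose posets may have cohomology through level 0, are cut
off. *)
Definition top_cohomology (a : V) : {vspace Cochain F (P a) k} :=
  if (k < level a)%N then cohomology F (P a) k else 0%VS.

Lemma level_path (u : posV G) w :
  sorted (@adj N G) (map val (u :: w)) -> (size w < level (val u))%N.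
Proof.
elim: w u => [|v w IHw] u; first by move=> _; exact: (valP u).
by case/andP=> /level_adj-> /IHw.
Qed.

(** Only the first letter of the word contributes to the sum; a word starting
at level at most [k] runs out of positive levels, so it is not a path. *)
Lemma toB_path_retract w : size w = k.+1 ->
  toB (monom F w) =
    \sum_(a | (k < level a)%N) B_of_cochain (cochain_of k a (monom F w)).
Proof.
case: w => // u w [size_w]; pose a := val u.
have other b : (k < level b)%N && (b != a) ->
    B_of_cochain (cochain_of k b (monom F (u :: w))) = 0.
  case/andP=> lt_kb neq_ba.
  by rewrite (@cochain_of_other _ _ _ _ a) 1?eq_sym ?linear0.
have [lt_ka | le_ak] := ltnP k (level a).
  rewrite (bigD1 a) //= big1 // addr0; apply: toB_eq.
  by apply: monom_path_retract => //=; rewrite size_w.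
rewrite big1 => [|b lt_kb]; last first.
  by apply: other; rewrite lt_kb; apply: contraTneq lt_kb => ->; rewrite -leqNgt.
apply/toB_eq0/in_ideal_monom_nonpath; apply: contraTN le_ak => /level_path.
by rewrite size_w -ltnNge.
Qed.

(** The part of a cochain that lies in the coboundaries dies in the algebra, so
the chosen complements already reach everything. *)
Lemma B_gradedS_cohomology x : B_graded F G k.+1 x <->
  exists h : forall a, Cochain F (P a) k,
    (forall a, h a \in top_cohomology a) /\ x = \sum_a B_of_cochain (h a).
Proof.
rewrite B_gradedE; split=> [[c ->] | [h [top_h ->]]].
  pose p := \sum_w c w *: monom F w.
  pose h a := if (k < level a)%N then
    daddv_pi (cohomology F (P a) k) (coboundaries F (P a) k) (cochain_of k a p)
    else 0.
  exists h; split=> [a|].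
    by rewrite /h /top_cohomology; case: ifP => _; [exact: memv_pi | exact: mem0v].
  have -> : toB p = \sum_(a | (k < level a)%N) B_of_cochain (cochain_of k a p).
    rewrite /p [toB _]linear_sum.
    transitivity (\sum_(w : k.+1.-tuple (posV G)) \sum_(a | (k < level a)%N)
        c w *: B_of_cochain (cochain_of k a (monom F w))).
      apply: eq_bigr => w _; rewrite /= [toB _]linearZ /= -scaler_sumr.
      by rewrite toB_path_retract ?size_tuple.
    rewrite exchange_big; apply: eq_bigr => a _ /=.
    rewrite [cochain_of _ _ _]linear_sum /= [B_of_cochain _]linear_sum /=.
    by apply: eq_bigr => w _; rewrite /= [cochain_of _ _ (_ *: _)]linearZ /= linearZ.
  rewrite [LHS]big_mkcond; apply: eq_bigr => a _; rewrite /h; case: ifP => lt_ka.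
    have : cochain_of k a p \in (cohomology F (P a) k + coboundaries F (P a) k)%VS.
      exact: (mem_top_cochain _ (no_long_chain lt_ka)).
    move/(daddv_pi_add (capv_diff _ _)) => def_f.
    rewrite -{1}def_f linearD /= [X in _ + X](_ : _ = 0) ?addr0 //.
    by apply/toB_eq0/paths_of_coboundary => //; exact: memv_pi.
  by rewrite linear0.
have graded0 : B_graded F G k.+1 0.
  apply/B_gradedE; exists (fun=> 0).
  by rewrite big1 ?linear0 // => w _; rewrite scale0r.
apply/B_gradedE; apply: (big_ind (B_graded F G k.+1)) => // [x1 x2 |a _].
  move=> /B_gradedE[c1 ->] /B_gradedE[c2 ->].
  apply/B_gradedE; exists (fun w => c1 w + c2 w); rewrite -linearD -big_split /=.
  by congr toB; apply: eq_bigr => w _; rewrite scalerDl.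
have := top_h a; rewrite /top_cohomology; case: ifP => [lt_ka _|_]; last first.
  by rewrite memv0 => /eqP->; rewrite linear0.
pose wd (s : chain (P a) k) := Tuple (introT eqP (size_path_word lt_ka s)).
apply/B_gradedE.
exists (fun w => \sum_(s : chain (P a) k) cval (h a) s * (wd s == w)%:R).
congr toB; rewrite /paths_of.
rewrite [RHS](eq_bigr (fun w => \sum_(s : chain (P a) k)
  (cval (h a) s * (wd s == w)%:R) *: monom F w)); last first.
  by move=> w _; rewrite scaler_suml.
rewrite exchange_big; apply: eq_bigr => s _ /=.
rewrite (bigD1 (wd s)) //= eqxx mulr1 big1 ?addr0 // => w /negPf ws.
by rewrite eq_sym ws mulr0 scale0r.
Qed.

(** Applying [cochain_of] at the vertex [b] to a relation between the summands
isolates the component at [b] and shows that it is a coboundary; a complement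
of the coboundaries contains no nonzero coboundary. *)
Lemma B_of_cochain_direct (h : forall a, Cochain F (P a) k) :
    (forall a, h a \in top_cohomology a) -> \sum_a B_of_cochain (h a) = 0 ->
  forall a, h a = 0.
Proof.
move=> top_h sum0 b; have := top_h b; rewrite /top_cohomology.
case: ifP => [lt_kb top_hb | _]; last by rewrite memv0 => /eqP.
apply: cohomology_coboundary0 => //.
have idl_h : in_idl (\sum_a paths_of (h a)).
  by apply/toB_eq0; rewrite [toB _]linear_sum.
have := cochain_of_ideal lt_kb idl_h; rewrite [cochain_of _ _ _]linear_sum /=.
rewrite (bigD1 b) //= (paths_ofK lt_kb) big1 ?addr0 // => a neq_ab.
have := top_h a; rewrite /top_cohomology; case: ifP => [lt_ka _ | _].
  exact: paths_of_other.
by rewrite memv0 => /eqP->; rewrite linear0 linear0.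
Qed.

End Degree.

Lemma has_dim_B0 : has_dim (B_graded F G 0) 1.
Proof.
exists (fun=> 1); split=> [x | c].
  split=> [[c ->] | [c ->]].
    exists (fun=> c [tuple]); rewrite big_ord1 (bigD1 [tuple]) //= big_nil.
    by rewrite big1 ?addr0 // => w; rewrite tuple0.
  exists (fun=> c ord0); rewrite big_ord1 (bigD1 [tuple]) //= big_nil.
  by rewrite big1 ?addr0 // => w; rewrite tuple0.
rewrite big_ord1 => /eqP; rewrite scaler_eq0 oner_eq0 orbF => /eqP c0 i.
by rewrite ord1.
Qed.

Lemma has_dim_BS k : has_dim (B_graded F G k.+1)
  (\sum_(a : V | (k < level a)%N)
     \dim (cohomology F (vposet (lower_graph a k.+1)) k)).
Proof.
rewrite big_mkcond (eq_bigr (fun a => \dim (top_cohomology k a))).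
  apply: (has_dim_direct_sum (f := fun a => @B_of_cochain k a)) => [x | h].
    exact: B_gradedS_cohomology.
  exact: B_of_cochain_direct.
by move=> a _; rewrite /top_cohomology; case: ifP; rewrite ?dimv0.
Qed.

End Graded.

(** * The Hilbert series *)

Theorem theorem3p1p1 (F : fieldType) (N : nat) (G : layeredGraph N)
    (unifG : uniform G) :
  is_hilbert_series (B_graded F G)
    (fun n => (1 + \sum_(a : vertex G) \sum_(1 <= i < (level a).+1)
                     'X^i *+ \dim (cohomology F (vposet (lower_graph a i)) (i - 1))
               : {poly nat})`_n).
Proof.
case=> [|k]; rewrite coefD coef1 coef_sum /=.
  rewrite big1 ?addr0; first exact: has_dim_B0.
  move=> a _; rewrite coef_sum big_nat big1 // => i /andP[i_gt0 _].
  by rewrite coefMn coefXn eq_sym (negPf (lt0n_neq0 i_gt0)) mul0rn.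
rewrite add0r; set d := (X in has_dim _ X).
suff -> : d = \sum_(a : vertex G | (k < level a)%N)
     \dim (cohomology F (vposet (lower_graph a k.+1)) k) by exact: has_dim_BS.
rewrite [RHS]big_mkcond; apply: eq_bigr => a _; rewrite coef_sum.
case: ltnP => [lt_ka | le_ak]; last first.
  rewrite big_nat big1 // => i /andP[_ lt_ia]; rewrite coefMn coefXn.
  by rewrite gtn_eqF ?mul0rn //; lia.
rewrite (bigD1_seq k.+1) ?iota_uniq ?mem_index_iota //= big1 => [|i /negPf neq_ik].
  by rewrite coefMn coefXn eqxx addr0 subn1 /= natn.
by rewrite coefMn coefXn eq_sym neq_ik mul0rn.
Qed.
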